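(* Let $B$ be a bouquet with intersection graph $I(B)$, let $S$ be the set of non-orientable loops of $B$, and let $F\subseteq E(B)$, $F^c=E(B)\setminus F$. Then (1) $\varepsilon(B^{\tau(F)})=\operatorname{rank}(\mathbf A_{(I(B),S\Delta F)})$; (2) $\varepsilon(B^{\delta(F)})=\operatorname{rank}(\mathbf A_{(I(B),S)}[F])+\operatorname{rank}(\mathbf A_{(I(B),S)}[F^c])$; (3) $\varepsilon(B^{\delta\tau(F)})=\operatorname{rank}(\mathbf A_{(I(B),S\Delta F)}[F])+\operatorname{rank}(\mathbf A_{(I(B),S)}[F^c])$; (4) $\varepsilon(B^{\tau\delta(F)})=\operatorname{rank}(\mathbf A_{(I(B),S\Delta F)})-\operatorname{corank}(\mathbf A_{(I(B),S)}[F])$; (5) $\varepsilon(B^{\tau\delta\tau(F)})=\operatorname{rank}(\mathbf A_{(I(B),S)})-\operatorname{corank}(\mathbf A_{(I(B),S\Delta F)}[F])$.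
   Context: A ribbon graph $G$ is a surface with boundary represented as a union of vertex discs $V(G)$ and edge discs $E(G)$ such that vertices and edges meet in disjoint line segments, each lying on the boundary of exactly one vertex and one edge, and each edge contains exactly two such segments. $v(G),e(G),f(G),c(G)$ denote the numbers of vertices, edges, boundary components and connected components; the Euler genus is $\varepsilon(G)=2c(G)-v(G)+e(G)-f(G)$. For $A\subseteq E(G)$, the partial dual $G^{\delta(A)}$ is obtained by gluing a disc along each boundary component of the spanning ribbon subgraph $(V(G),A)$ (these become the vertices), removing the interiors of the original vertex discs, and keeping the edge ribbons; the partial Petrial $G^{\tau(A)}$ is obtained by adding a half-twist to each edge in $A$. For a word $w=w_1\cdots w_n$ over $\{\delta,\tau\}$, $G^{w(A)}:=(\cdots(G^{w_n(A)})^{w_{n-1}(A)}\cdots)^{w_1(A)}$. A bouquet is a ribbon graph with one vertex. A loop $e$ at $v$ is non-orientable if $e\cup v$ is a Möbius band. Two loops are interlaced if their ends alternate along the vertex boundary. $I(B)$ is the simple graph on $E(B)$ with adjacency meaning interlaced; subsets of $E(B)$ are identified with vertex subsets of $I(B)$. For a simple graph $G$ and $L\subseteq V(G)$, $\mathbf A_{(G,L)}$ is the $V(G)\times V(G)$ matrix over $\mathrm{GF}(2)$ with $(u,v)$-entry $1$ iff ($u\ne v$ adjacent) or ($u=v\in L$). $M[A]$ denotes the principal submatrix on $A$; ranks are over $\mathrm{GF}(2)$, the empty matrix has rank $0$, and $\operatorname{corank}$ of a square matrix is its size minus its rank. $\Delta$ is symmetric difference. *)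

(* Defs.v *)
From HB Require Import structures.
From mathcomp Require Import all_boot all_order all_algebra.

Set Implicit Arguments.
Unset Strict Implicit.
Unset Printing Implicit Defensive.

Import GRing.Theory.

(** * Ribbon graphs

    A ribbon graph, up to homeomorphism, is encoded by its corners: the end
    points of the line segments in which edge discs meet vertex discs.  Each
    edge has four corners, and every corner x is an end of exactly three arcs
    - the line segment (edge end) containing x, whose other end is [seg x];
    - a free side of the edge disc, whose other end is [side x];
    - an arc of the vertex boundary between consecutive edge ends (possibly
      twice the same one), whose other end is [arc x].
    Vertex discs meeting no edge have no corners and are only counted, by
    [isolated].  Here E is the set of edges. *)
Record ribbonGraph (E : finType) := RibbonGraph {
  corner : finType;
  edge : corner -> E;
  side : corner -> corner;
  seg : corner -> corner;
  arc : corner -> corner;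
  isolated : nat;
  sideK : involutive side;
  segK : involutive seg;
  arcK : involutive arc;
  side_neq : forall x, side x != x;
  seg_neq : forall x, seg x != x;
  arc_neq : forall x, arc x != x;
  side_segC : forall x, side (seg x) = seg (side x);
  side_seg_neq : forall x, side (seg x) != x;
  edge_side : forall x, edge (side x) = edge x;
  edge_seg : forall x, edge (seg x) = edge x;
  edge_corners : forall x y, edge y = edge x ->
    y \in [:: x; side x; seg x; side (seg x)];
  edge_surj : forall e, exists x, edge x = e
}.

Definition norbits (T : finType) (s : seq (T -> T)) : nat :=
  n_comp (fun x y : T => has (fun h => h x == y) s) T.

Section EulerGenus.
Variables (E : finType) (G : ribbonGraph E).

Definition nvertices : nat := norbits [:: @seg E G; @arc E G] + isolated G.
Definition nedges : nat := #|E|.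
Definition nfaces : nat := norbits [:: @side E G; @arc E G] + isolated G.
Definition ncomponents : nat :=
  norbits [:: @side E G; @seg E G; @arc E G] + isolated G.

Definition euler_genus : int :=
  (ncomponents.*2%:Z - nvertices%:Z + nedges%:Z - nfaces%:Z)%R.

Definition bouquet : Prop := nvertices = 1.

(* The union of all the vertex discs and of the single edge disc e is
   non-orientable.  An orientation of a disc alternately colours the corners met
   along its boundary.  When e joins distinct vertices the union is always
   orientable; when e is a loop it is non-orientable exactly when e and its
   vertex form a Moebius band. *)
Definition nonorientable (e : E) : bool :=
  ~~ [exists s : {ffun corner G -> bool},
       [forall x, [&& s (seg x) != s x, s (arc x) != s x
                    & (edge x == e) ==> (s (side x) != s x)]]].

Definition nonorientable_loops : {set E} := [set e | nonorientable e].

(* One step along the vertex boundary: cross an edge end, then follow the arc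
   to the next one.  The orbit of a corner meets every edge end at its vertex
   exactly once, in cyclic order. *)
Definition next_end (x : corner G) : corner G := arc (seg x).

Definition interlaced (e f : E) : bool :=
  (e != f) &&
  [exists x, [seq g <- [seq edge y | y <- orbit next_end x] | g \in [:: e; f]]
               == [:: e; f; e; f]].

Lemma next_end_inj : injective next_end.
Proof.
by move=> x y /(can_inj (@arcK _ G)) /(can_inj (@segK _ G)).
Qed.

Lemma filter_map_cons (T : eqType) (P : pred T) (U : Type) (h : U -> T)
    (s : seq U) (a : T) (r : seq T) :
  [seq g <- map h s | P g] = a :: r ->
  exists s1 y s2, [/\ s = s1 ++ y :: s2, [seq g <- map h s1 | P g] = [::],
    P (h y), h y = a & [seq g <- map h s2 | P g] = r].
Proof.
elim: s => //= x s IHs; case: ifP => [Px [<- <-]|Px].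
  by exists [::], x, s.
move=> /IHs [s1 [y [s2 [-> s1P Py hy s2P]]]].
by exists (x :: s1), y, s2; split=> //=; rewrite Px.
Qed.

Lemma interlaced_sym : symmetric interlaced.
Proof.
suff imp e f : interlaced e f -> interlaced f e.
  by move=> e f; apply/idP/idP; apply: imp.
case/andP=> nef /existsP[x /eqP/filter_map_cons].
move=> [s1 [y [s2 [xE s1P Py hy]]]].
move=> /filter_map_cons [t1 [z [t2 [s2E t1P Pz hz t2P]]]].
rewrite /interlaced eq_sym nef /=; apply/existsP; exists z.
have cyc : fcycle next_end (orbit next_end x) := cycle_orbit next_end_inj x.
have zin : z \in orbit next_end x.
  by rewrite xE s2E !(mem_cat, inE) eqxx !orbT.
rewrite (orbitE cyc (orbit_uniq _ _) zin).
have xE' : orbit next_end x = (s1 ++ y :: t1) ++ z :: t2.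
  by rewrite xE s2E -catA.
have -> : index z (orbit next_end x) = size (s1 ++ y :: t1).
  have := orbit_uniq next_end x; rewrite xE' cat_uniq => /and3P[_ /hasPn nin _].
  by rewrite index_cat (negPf (nin z (mem_head _ _))) /= eqxx addn0.
rewrite xE' rot_size_cat !(map_cat, filter_cat) /=.
have PE : (fun g => g \in [:: f; e]) =1 (fun g => g \in [:: e; f]).
  by move=> g; rewrite !inE orbC.
by rewrite !(eq_filter PE) PE PE s1P t1P t2P Pz Py hz hy.
Qed.

Lemma interlaced_irr : irreflexive interlaced.
Proof. by move=> e; rewrite /interlaced eqxx. Qed.

End EulerGenus.

(** * Partial duals, partial Petrials and twisted duals *)

Section PartialDual.
Variables (E : finType) (A : {set E}) (G : ribbonGraph E).

(* The boundary of the spanning ribbon subgraph (V, A) follows the free sides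
   of the edges in A and the ends of the deleted edges, so the new vertices are
   glued to the edges of A along their former free sides. *)
Definition dual_side (x : corner G) := if edge x \in A then seg x else side x.
Definition dual_seg (x : corner G) := if edge x \in A then side x else seg x.

Lemma dual_edge_side x : edge (dual_side x) = edge x.
Proof. by rewrite /dual_side; case: ifP; rewrite ?edge_seg ?edge_side. Qed.

Lemma dual_sideK : involutive dual_side.
Proof.
move=> x; rewrite {1}/dual_side dual_edge_side /dual_side.
by case: (edge x \in A); rewrite (segK, sideK).
Qed.

Lemma dual_edge_seg x : edge (dual_seg x) = edge x.
Proof. by rewrite /dual_seg; case: ifP; rewrite ?edge_seg ?edge_side. Qed.

Lemma dual_segK : involutive dual_seg.
Proof.
move=> x; rewrite {1}/dual_seg dual_edge_seg /dual_seg.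
by case: (edge x \in A); rewrite (segK, sideK).
Qed.

Lemma dual_side_neq x : dual_side x != x.
Proof. by rewrite /dual_side; case: ifP; rewrite ?seg_neq ?side_neq. Qed.

Lemma dual_seg_neq x : dual_seg x != x.
Proof. by rewrite /dual_seg; case: ifP; rewrite ?seg_neq ?side_neq. Qed.

Lemma dual_side_segE x : dual_side (dual_seg x) = side (seg x).
Proof.
rewrite /dual_side dual_edge_seg /dual_seg.
by case: (edge x \in A); rewrite ?side_segC.
Qed.

Lemma dual_side_segC x : dual_side (dual_seg x) = dual_seg (dual_side x).
Proof.
rewrite dual_side_segE /dual_seg dual_edge_side /dual_side.
by case: (edge x \in A); rewrite ?side_segC.
Qed.

Lemma dual_side_seg_neq x : dual_side (dual_seg x) != x.
Proof. by rewrite dual_side_segE side_seg_neq. Qed.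

Lemma dual_edge_corners (x y : corner G) : edge y = edge x ->
  y \in [:: x; dual_side x; dual_seg x; dual_side (dual_seg x)].
Proof.
move=> /edge_corners; rewrite dual_side_segE /dual_side /dual_seg !inE.
by case: ifP => // _ /or4P[] -> //; rewrite ?orbT.
Qed.

Definition partial_dual : ribbonGraph E :=
  RibbonGraph (isolated G) dual_sideK dual_segK (@arcK _ G) dual_side_neq
    dual_seg_neq (@arc_neq _ G) dual_side_segC dual_side_seg_neq
    dual_edge_side dual_edge_seg dual_edge_corners (@edge_surj _ G).

(* A half-twist interchanges the two corners at one end of the edge. *)
Definition petrie_side (x : corner G) :=
  if edge x \in A then side (seg x) else side x.

Lemma petrie_edge_side x : edge (petrie_side x) = edge x.
Proof. by rewrite /petrie_side; case: ifP; rewrite edge_side ?edge_seg. Qed.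

Lemma petrie_sideK : involutive petrie_side.
Proof.
move=> x; rewrite {1}/petrie_side petrie_edge_side /petrie_side.
by case: (edge x \in A); rewrite -?side_segC ?segK sideK ?segK.
Qed.

Lemma petrie_side_neq x : petrie_side x != x.
Proof. by rewrite /petrie_side; case: ifP; rewrite ?side_seg_neq ?side_neq. Qed.

Lemma petrie_side_segC x : petrie_side (seg x) = seg (petrie_side x).
Proof. by rewrite /petrie_side edge_seg; case: ifP; rewrite !side_segC. Qed.

Lemma petrie_side_seg_neq x : petrie_side (seg x) != x.
Proof.
rewrite /petrie_side edge_seg segK; case: ifP => _; first exact: side_neq.
exact: side_seg_neq.
Qed.

Lemma petrie_edge_corners (x y : corner G) : edge y = edge x ->
  y \in [:: x; petrie_side x; seg x; petrie_side (seg x)].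
Proof.
move=> /edge_corners; rewrite /petrie_side edge_seg segK !inE.
by case: ifP => // _ /or4P[] -> //; rewrite ?orbT.
Qed.

Definition partial_petrial : ribbonGraph E :=
  RibbonGraph (isolated G) petrie_sideK (@segK _ G) (@arcK _ G)
    petrie_side_neq (@seg_neq _ G) (@arc_neq _ G) petrie_side_segC
    petrie_side_seg_neq petrie_edge_side (@edge_seg _ G) petrie_edge_corners
    (@edge_surj _ G).

End PartialDual.

Inductive letter := delta | tau.

Definition letter_act (E : finType) (A : {set E}) (l : letter)
    (G : ribbonGraph E) : ribbonGraph E :=
  match l with
  | delta => partial_dual A G
  | tau => partial_petrial A G
  end.

(* The last letter of the word acts first. *)
Definition twisted_dual (E : finType) (G : ribbonGraph E) (w : seq letter)
    (A : {set E}) : ribbonGraph E :=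
  foldr (letter_act A) G w.

(** * Simple graphs and their matrices over GF(2) *)

Record simpleGraph (V : finType) := SimpleGraph {
  adj :> rel V;
  adj_sym : symmetric adj;
  adj_irr : irreflexive adj
}.

Definition intersection_graph (E : finType) (B : ribbonGraph E) :
    simpleGraph E :=
  SimpleGraph (@interlaced_sym E B) (@interlaced_irr E B).

(* Rows and columns are indexed by V through [enum_val] / [enum_rank]. *)
Definition adjmx (V : finType) (G : simpleGraph V) (L : {set V}) :
    'M['F_2]_#|V| :=
  \matrix_(i, j)
    (((i != j) && G (enum_val i) (enum_val j))
     || ((i == j) && (enum_val i \in L)))%:R%R.

Definition principal (V : finType) (M : 'M['F_2]_#|V|) (A : {set V}) :
    'M['F_2]_#|A| :=
  mxsub (fun i : 'I_#|A| => enum_rank (enum_val i))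
        (fun j : 'I_#|A| => enum_rank (enum_val j)) M.

Definition corank (n : nat) (M : 'M['F_2]_n) : nat := n - \rank M.

Definition symdiff (T : finType) (A B : {set T}) : {set T} :=
  (A :\: B) :|: (B :\: A).

(* Main.v *)
From mathcomp Require Import all_boot all_order all_algebra.
From mathcomp Require Import mxabelem zify.
Require Import Defs.

Set Implicit Arguments.
Unset Strict Implicit.
Unset Printing Implicit Defensive.

Import GRing.Theory.

(** The orbits of a family of involutions are counted by the functions to GF(2)
    that they leave invariant: k orbits carry 2^k such functions.  On the
    boundary circle of the vertex of B, let chi_g be the function (a
    "potential", unique up to a constant) that is constant on arcs and jumps by 1
    across both ends of the edge g.  Along a side of an edge e, chi_g changes by 1
    exactly when e and g are interlaced (g <> e) or e is non-orientable (g = e),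
    and along the diagonal of the edge disc, i.e. after a half-twist, there is
    one more jump when g = e.  Hence, if the boundary follows the edge ends
    outside A, the sides of the edges in A \ P and the diagonals of the edges in
    A :&: P, the invariant functions are c + \sum_(g in A) z_g chi_g with z in the
    kernel of the matrix of (I(B), S Delta P) restricted to A, and the number of
    orbits is 1 plus the corank of this matrix.  Every vertex and face count in
    the theorem is of this form, with P empty or F. *)

(** * Orbits of involutions counted by invariant functions *)

Section InvariantFunctions.
Variable T : finType.
Implicit Types s : seq (T -> T).

Definition step s : rel T := fun x y => has (fun h => h x == y) s.

Lemma step_sym_cons h s :
  involutive h -> symmetric (step s) -> symmetric (step (h :: s)).
Proof.
by move=> hK sym_s x y; rewrite /step /= -!/(step s _ _) sym_s (inv_eq hK) eq_sym.
Qed.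

Lemma step_sym2 h k : involutive h -> involutive k -> symmetric (step [:: h; k]).
Proof. by move=> hK kK; do 2!apply: step_sym_cons => //. Qed.

Lemma step_sym3 h k l : involutive h -> involutive k -> involutive l ->
  symmetric (step [:: h; k; l]).
Proof. by move=> hK kK lK; do 3!apply: step_sym_cons => //. Qed.

Definition fun_invariant (R : eqType) s (f : T -> R) :=
  all (fun h => [forall x, f (h x) == f x]) s.

Lemma fun_invariantP (R : eqType) s (f : T -> R) :
  reflect (forall x y, step s x y -> f y = f x) (fun_invariant s f).
Proof.
rewrite /fun_invariant /step; elim: s => [|h s IHs] /=; first by left.
apply: (iffP andP) => [[/forallP fh /IHs fs] x y /orP[/eqP<-|/fs //]|fs].
  exact/eqP.
split; first by apply/forallP=> x; apply/eqP/fs; rewrite eqxx.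
by apply/IHs=> x y xy; apply: fs; rewrite xy orbT.
Qed.

Lemma connect_invariant (R : eqType) s (f : T -> R) x y :
  fun_invariant s f -> connect (step s) x y -> f y = f x.
Proof.
move=> /fun_invariantP fs /connectP[p].
elim: p x => [|z p IHp] x /=; first by move=> _ ->.
by case/andP=> /fs <- zp /(IHp _ zp).
Qed.

Lemma root_invariant (R : eqType) s (f : T -> R) x :
  fun_invariant s f -> f (fingraph.root (step s) x) = f x.
Proof. by move/connect_invariant; apply; apply: connect_root. Qed.

Lemma norbits_le1_invariant (R : eqType) s (f : T -> R) :
  symmetric (step s) -> norbits s <= 1 -> fun_invariant s f ->
  forall x y, f x = f y.
Proof.
move=> /sym_connect_sym sym_s s1 fs x y.
rewrite -(root_invariant x fs) -(root_invariant y fs).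
congr f; apply: (card_le1_eqP s1); apply/andP; split=> //; exact: roots_root.
Qed.

(** An invariant function is determined by its values at the canonical roots, one per orbit, and
    these are arbitrary: [lift] spreads them over the orbits. *)
Lemma card_invariant s : symmetric (step s) ->
  #|[set f : {ffun T -> 'F_2} | fun_invariant s f]| = 2 ^ norbits s.
Proof.
move=> /sym_connect_sym sym_s.
pose A : pred T := fingraph.roots (step s).
pose lift (g : {ffun T -> 'F_2}) := [ffun x => g (fingraph.root (step s) x)].
have <- : #|lift @: pffun_on 0%R A predT| = 2 ^ norbits s.
  rewrite card_in_imset => [|g g' /pffun_onP[g0 _] /pffun_onP[g'0 _] eq_gg'].
    rewrite card_pffun_on card_Fp //; congr (_ ^ _).
    by apply: eq_card => x; rewrite !inE andbT.
  apply/ffunP=> x; have [Ax|nAx] := boolP (x \in A).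
    by have /ffunP/(_ x) := eq_gg'; rewrite !ffunE (eqP Ax).
  by rewrite (supportP g0 x nAx) (supportP g'0 x nAx).
congr #|pred_of_set _|; apply/setP=> f; rewrite inE; apply/idP/imsetP => [fs | [g _ ->]].
  exists [ffun x => if x \in A then f x else 0%R].
    apply/pffun_onP; split=> //; apply/supportP => x.
    by rewrite ffunE => /negPf->.
  apply/ffunP=> x; rewrite !ffunE /A.
  by rewrite -topredE /= (roots_root sym_s) root_invariant.
apply/fun_invariantP=> x y /connect1/(fingraph.rootP sym_s) xy.
by rewrite !ffunE xy.
Qed.

(** Families are compared through their invariants, with no matching of orbits. *)
Lemma norbits_eq s s' : symmetric (step s) -> symmetric (step s') ->
  (forall f : T -> 'F_2, fun_invariant s f = fun_invariant s' f) ->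
  norbits s = norbits s'.
Proof.
move=> sym_s sym_s' eq_inv; apply: (@expnI 2) => //.
by rewrite -!card_invariant //; apply: eq_card => f; rewrite !inE eq_inv.
Qed.

End InvariantFunctions.

(** * The boundary circle of the single vertex *)

Section Bouquet.
Variables (E : finType) (B : ribbonGraph E).
Hypothesis hB : bouquet B.
Implicit Types (x y z : corner B) (e g : E).

Local Notation nxt := (@next_end E B).

Lemma edge_next_end_seg x : nxt (seg (arc x)) = x.
Proof. by rewrite /next_end segK arcK. Qed.

(* A word of odd length in two involutions is conjugate to one of them, hence
   has no fixed point if they have none. *)
Lemma iter_next_end_neq n x : iter n nxt x != seg x.
Proof.
(* The claim for [n] at [nxt x] yields it for [n.+2] at [x], so two consecutive values are
   carried. *)
suff [] : (forall x, iter n nxt x != seg x) /\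
          (forall x, iter n.+1 nxt x != seg x) by move=> /(_ x).
elim: n {x} => [|n [IHn IHn1]].
  split=> x /=; first by rewrite eq_sym seg_neq.
  exact: (arc_neq (seg x)).
split=> // x.
rewrite iterS iterSr; apply: contraNneq (IHn (nxt x)) => nx.
by rewrite -[seg (nxt x)]/(seg (arc (seg x))) -nx [nxt (iter _ _ _)]/next_end arcK segK.
Qed.

Lemma bouquet_connected (R : eqType) (f : corner B -> R) :
  (forall x, f (seg x) = f x) -> (forall x, f (arc x) = f x) ->
  forall x y, f x = f y.
Proof.
move=> fseg farc; apply: (@norbits_le1_invariant _ _ [:: @seg E B; @arc E B]).
- by apply: step_sym2; [apply: segK | apply: arcK].
- by move: hB; rewrite /bouquet /nvertices => <-; rewrite leq_addr.
- by rewrite /fun_invariant /= andbT; apply/andP; split; apply/forallP=> x; apply/eqP.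
Qed.

Lemma fconnect_arc x y : fconnect nxt x (arc y) = fconnect nxt x (seg y).
Proof.
by rewrite [RHS](same_fconnect1_r (@next_end_inj E B)) /next_end segK.
Qed.

(** An orbit of [nxt] runs round the vertex in one direction and contains one corner of every edge
    end: never both, by [iter_next_end_neq], and at least one, by connectedness. *)
Lemma fconnect_seg x y : fconnect nxt x (seg y) = ~~ fconnect nxt x y.
Proof.
have one_side z : fconnect nxt x z -> ~~ fconnect nxt x (seg z).
  move=> xz; apply/negP => xsz; have zsz : fconnect nxt z (seg z).
    by rewrite (fconnect_sym (@next_end_inj E B)) in xz; apply: connect_trans xsz.
  by have := iter_next_end_neq (findex nxt z (seg z)) z; rewrite iter_findex ?eqxx.
apply/idP/idP=> [xsy|]; first by rewrite -[y](segK) one_side.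
have /(_ y x) : forall u v, fconnect nxt x u || fconnect nxt x (seg u)
                          = fconnect nxt x v || fconnect nxt x (seg v).
  apply: bouquet_connected => u; first by rewrite segK orbC.
  rewrite fconnect_arc orbC -fconnect_arc arcK //.
by rewrite connect0 /=; case: (fconnect nxt x y).
Qed.

(** The orbit meets each of the two ends of an edge in one corner; [z] is the one at the end
    opposite to [y]. *)
Lemma edge_end_pair x y : fconnect nxt x y ->
  exists z, [/\ z \in [:: side y; seg (side y)], fconnect nxt x z, z != y &
    forall u, fconnect nxt x u -> edge u = edge y -> u = y \/ u = z].
Proof.
move=> xy; exists (if fconnect nxt x (side y) then side y else seg (side y)).
split.
- by case: ifP; rewrite !inE eqxx ?orbT.
- by case: ifPn => //; rewrite fconnect_seg.
- by case: ifP; rewrite ?side_neq // -side_segC side_seg_neq.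
move=> u xu /edge_corners; rewrite side_segC !inE => /or4P[] /eqP uE; first by left.
- by right; rewrite uE in xu *; rewrite xu.
- by move: xu; rewrite uE fconnect_seg xy.
- by right; move: xu; rewrite uE fconnect_seg; case: (fconnect nxt x (side y)).
Qed.

(** A full turn passes both ends of [e]; as 2 vanishes in GF(2), a potential can close up. *)
Lemma count_edge_orbit x e :
  count_mem e [seq edge y | y <- orbit nxt x] = 2.
Proof.
have [w we] := edge_surj B e.
without loss xw : w we / fconnect nxt x w.
  move=> IH; have [|nxw] := boolP (fconnect nxt x w); first exact: IH.
  by apply: (IH (seg w)); rewrite ?edge_seg ?fconnect_seg.
have [z [zw xz zNw uniq_wz]] := edge_end_pair xw.
rewrite count_map -size_filter; suff /perm_size -> :
  perm_eq [seq y <- orbit nxt x | preim (@edge E B) (pred1 e) y] [:: w; z] by [].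
apply: uniq_perm; rewrite ?filter_uniq ?orbit_uniq //=.
  by rewrite inE eq_sym zNw.
move=> u; rewrite mem_filter -fconnect_orbit /= !inE; apply/andP/orP.
  by move=> [/eqP ue xu]; have [] := uniq_wz u xu; rewrite ?ue //= => ->; [left|right].
case=> /eqP ->; rewrite ?we ?eqxx //; split=> //.
by move: zw; rewrite !inE => /orP[] /eqP->; rewrite ?edge_seg edge_side we.
Qed.

Local Open Scope ring_scope.

Lemma addF2K (b : 'F_2) : cancel (+%R^~ b) (+%R^~ b).
Proof. by move=> a; rewrite -addrA addrr_pchar2 ?addr0 ?pchar_Fp. Qed.

(** * Potentials on the boundary circle *)

Definition potential e (chi : corner B -> 'F_2) :=
  (forall x, chi (arc x) = chi x) /\
  (forall x, chi (seg x) = chi x + (edge x == e)%:R).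

(** An end is crossed on leaving its corner, so [x] is counted and [y] is not. *)
Lemma potential_path e chi x p y : potential e chi -> fpath nxt x (rcons p y) ->
  chi y = chi x + (count_mem e [seq edge z | z <- x :: p])%:R.
Proof.
move=> [chi_arc chi_seg]; have chi_next u : chi (nxt u) = chi u + (edge u == e)%:R.
  by rewrite /next_end chi_arc.
elim: p x => [|z p IHp] x /=; first by rewrite andbT addn0 => /eqP <-.
by case/andP=> /eqP <- /IHp ->; rewrite chi_next /= [in RHS]natrD addrA.
Qed.

Lemma potential_exists e : exists chi, potential e chi.
Proof.
have [x _] := edge_surj B e.
pose cnt k : 'F_2 := (count_mem e [seq edge z | z <- traject nxt x k])%:R.
have cntS k : cnt k.+1 = cnt k + (edge (iter k nxt x) == e)%:R.
  by rewrite /cnt trajectSr map_rcons -cats1 count_cat /= addn0 natrD.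
have cnt_next y : fconnect nxt x y ->
    cnt (findex nxt x (nxt y)) = cnt (findex nxt x y).+1.
  move=> xy; rewrite -{1}(iter_findex xy) -iterS.
  have := findex_max xy; rewrite leq_eqVlt => /orP[/eqP k_max|k_lt].
    (* At the last corner the walk returns to [x]: the count restarts at 0, and a full turn
       contributes 2, which is 0. *)
    rewrite k_max (iter_order (@next_end_inj E B)) findex0 /cnt /=.
    by rewrite -/(orbit nxt x) count_edge_orbit; apply/val_inj.
  by rewrite findex_iter.
(* A corner [y] off the orbit is reached by crossing the end entered at [seg y]; the [.+1] includes
   that end in the count. *)
pose chi y := if fconnect nxt x y then cnt (findex nxt x y)
              else cnt (findex nxt x (seg y)).+1.
exists chi; split=> y; rewrite /chi.
  rewrite fconnect_arc fconnect_seg; have [xy|nxy] /= := boolP (fconnect nxt x y).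
    rewrite -cnt_next ?edge_next_end_seg //.
    by rewrite fconnect_seg fconnect_arc fconnect_seg xy.
  by rewrite -cnt_next ?fconnect_seg // /next_end segK.
rewrite fconnect_seg segK; have [xy|nxy] /= := boolP (fconnect nxt x y).
  by rewrite cntS iter_findex.
rewrite cntS iter_findex; last by rewrite fconnect_seg.
by rewrite edge_seg addF2K.
Qed.

Lemma fpath_orbit x s1 y s2 z s3 :
  orbit nxt x = s1 ++ y :: s2 ++ z :: s3 -> fpath nxt y (rcons s2 z).
Proof.
move=> xE; have := cycle_orbit (@next_end_inj E B) x.
have : sorted (frel nxt) (orbit nxt x).
  by rewrite /orbit /order; case: #|_| => //= n; apply: fpath_traject.
rewrite xE => /cat_sorted2[_] /=.
by rewrite -cat_rcons cat_path => /andP[].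
Qed.

(** * Jumps of a potential along the side of an edge *)

(** Walking from one end of [e] to the other changes [chi] by the number of ends of [g] in between,
    which is odd exactly when the loops are interlaced. Both corners of an end of [e] have the same
    value. *)
Lemma potential_interlaced e g chi x : potential g chi -> edge x = e -> e != g ->
  chi (side x) = chi x + (interlaced B e g)%:R.
Proof.
move=> pot xe neg; have [chi_arc chi_seg] := pot.
have chi_e y : edge y = e -> chi (seg y) = chi y.
  by move=> ye; rewrite chi_seg ye (negPf neg) addr0.
have chi_se y : edge y = e -> chi (side (seg y)) = chi (side y).
  by move=> ye; rewrite side_segC chi_e ?edge_side.
have [|nI] := boolP (interlaced B e g).
  case/andP=> _ /existsP[w /eqP/filter_map_cons].
  move=> [s1 [y [s2 [wE _ _ ye]]]].
  move=> /filter_map_cons [t1 [u [t2 [s2E t1e _ ug]]]].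
  move=> /filter_map_cons [r1 [z [r2 [t2E r1e _ ze _]]]].
  have chi_z : chi z = chi y + 1.
    have p : orbit nxt w = s1 ++ y :: (t1 ++ u :: r1) ++ z :: r2.
      by rewrite wE s2E t2E -catA.
    rewrite (potential_path pot (fpath_orbit p)); congr (_ + _).
    have cnt0 t : [seq h <- [seq edge y | y <- t] | h \in [:: e; g]] = [::] ->
        count_mem g [seq edge y | y <- t] = 0%N.
      elim: t => //= v t IHt; rewrite !inE; case: eqP => //= _; case: eqP => //=.
    by rewrite /= ye (negPf neg) map_cat count_cat /= !cnt0 // ug eqxx.
  (* Since [chi] differs at [y] and [z], the corner [z] lies at the other end of [e]. *)
  have chi_sy : chi (side y) = chi y + 1.
    have nz : chi z <> chi y.
      by move/eqP; rewrite chi_z -subr_eq0 addrAC subrr add0r oner_eq0.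
    have /edge_corners : edge z = edge y by rewrite ze ye.
    rewrite !inE => /or4P[] /eqP zE; move: nz chi_z; rewrite zE ?chi_se ?chi_e //.
  have /edge_corners : edge x = edge y by rewrite xe.
  rewrite !inE => /or4P[] /eqP ->; rewrite ?(sideK, chi_se, chi_e, edge_side) //.
    by rewrite chi_sy addF2K.
  by rewrite chi_sy addF2K.
(* Conversely, if [chi] changes, the number of ends of [g] between [x] and [z] is odd; of the two,
   one lies before [z] and one after, so the ends read [e g e g] from [x]. *)
rewrite addr0; apply: contraNeq nI => neq_chi.
have [z [zx xz zNx only]] := edge_end_pair (connect0 (frel nxt) x).
have chi_z : chi z = chi (side x).
  by move: zx; rewrite !inE => /orP[] /eqP-> //; rewrite chi_e ?edge_side.
have ze : edge z = e.
  by move: zx; rewrite !inE => /orP[] /eqP->; rewrite ?edge_seg edge_side.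
have [s2 [s3 xE]] : exists s2 s3, orbit nxt x = x :: s2 ++ z :: s3.
  move: xz; rewrite fconnect_orbit /orbit -orderSpred /= inE (negPf zNx) /=.
  by case/splitPr=> s2 s3; exists s2, s3.
have sub_orbit t u : orbit nxt x = u ++ t -> {subset t <= orbit nxt x}.
  by move=> -> v vt; rewrite mem_cat vt orbT.
have := orbit_uniq nxt x; rewrite xE /= mem_cat inE cat_uniq /= !negb_or.
move=> /and5P[/and3P[xs2 _ xs3] _ /andP[zs2 _] zs3 _].
have no_e t : {subset t <= orbit nxt x} -> x \notin t -> z \notin t ->
    [seq h <- [seq edge y | y <- t] | h \in [:: e; g]]
      = nseq (count_mem g [seq edge y | y <- t]) g.
  move=> tx xt zt; have {tx xt zt} : {in t, forall y, edge y != e}.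
    move=> y yt; apply/eqP=> ye; have := only y.
    rewrite fconnect_orbit tx // xe => /(_ isT ye) [] yE; move: xt zt.
      by rewrite -yE yt.
    by rewrite -yE yt.
  elim: t => //= y t IHt ye; rewrite !inE (negPf (ye y (mem_head _ _))) /=.
  rewrite IHt => [|v vt]; last by rewrite ye // inE vt orbT.
  by case: eqP => [->|].
have := count_edge_orbit x g.
rewrite xE /= xe (negPf neg) map_cat count_cat /= ze (negPf neg) !add0n.
have := potential_path pot (fpath_orbit (xE : _ = [::] ++ _)).
rewrite chi_z /= xe (negPf neg) add0n => chi_x cnt2.
have c2 : count_mem g [seq edge y | y <- s2] = 1%N.
  move: cnt2 neq_chi; rewrite chi_x; case: (count_mem g _) => [|[|[|n]]] //.
    by rewrite addr0 eqxx.
  by rewrite (_ : 2%:R = 0) ?addr0 ?eqxx //; apply/val_inj.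
have c3 : count_mem g [seq edge y | y <- s3] = 1%N by move: cnt2; rewrite c2 => -[].
rewrite /interlaced neg; apply/existsP; exists x; rewrite xE /= map_cat filter_cat /=.
rewrite xe ze !inE eqxx /= !no_e ?c2 ?c3 //.
  by apply: (sub_orbit _ (x :: s2 ++ [:: z])); rewrite xE /= -catA.
by move=> v vs; rewrite xE inE mem_cat vs orbT.
Qed.

(* An alternating colouring s identifies the two corners of e lying on the same
   orbit of [next_end] as x and opposite ends of e. *)
Lemma potential_self (s : corner B -> bool) e chi x :
  (forall y, s (seg y) = ~~ s y) -> (forall y, s (arc y) = ~~ s y) ->
  potential e chi -> edge x = e -> chi (side x) = chi x + (s (side x) == s x)%:R.
Proof.
move=> s_seg s_arc pot xe; have [chi_arc chi_seg] := pot.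
have [z [zx xz zNx only]] := edge_end_pair (connect0 (frel nxt) x).
have s_z : s z = s x.
  case/connectP: xz => p; elim: p (x) => [|y p IHp] u /=; first by move=> _ ->.
  by case/andP=> /eqP <- /IHp IH /IH ->; rewrite /next_end s_arc s_seg negbK.
have [s2 [s3 xE]] : exists s2 s3, orbit nxt x = x :: s2 ++ z :: s3.
  move: xz; rewrite fconnect_orbit /orbit -orderSpred /= inE (negPf zNx) /=.
  by case/splitPr=> s2 s3; exists s2, s3.
(* On the way from [x] to [z] an end of [e] is crossed only at [x]. *)
have chi_z : chi z = chi x + 1.
  rewrite (potential_path pot (fpath_orbit (xE : _ = [::] ++ _))) /= xe eqxx.
  suff -> : count_mem e [seq edge y | y <- s2] = 0%N by [].
  rewrite count_map; apply/eqP.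
  rewrite -leqn0 leqNgt -has_count; apply/hasPn => y ys2 /=; apply/eqP=> ye.
  have := orbit_uniq nxt x; rewrite xE /= mem_cat cat_uniq /= !negb_or => uxz.
  have := only y; rewrite fconnect_orbit xE inE mem_cat ys2 orbT xe.
  case/(_ isT ye)=> yE; move: uxz; rewrite -yE ?ys2 //.
  by case/and4P=> _ _ /andP[].
move: zx; rewrite !inE => /orP[] /eqP zE; move: s_z chi_z; rewrite zE.
  by move=> -> ->; rewrite eqxx.
(* Here [z] is [seg (side x)], and the second crossing cancels the first. *)
rewrite s_seg chi_seg edge_side xe eqxx => s_side /addIr ->.
by rewrite -s_side; case: (s (side x)); rewrite addr0.
Qed.

(** A colouring that orients [e] gives no jump by [potential_self]. If there is none, the indicator
    of the orbit of [x] still alternates along the vertex boundary, so it must agree on [x] and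
    [side x], which gives the jump. *)
Lemma potential_nonorientable e chi x : potential e chi -> edge x = e ->
  chi (side x) = chi x + (nonorientable B e)%:R.
Proof.
move=> pot xe.
have flip (a b : bool) : a != b -> a = ~~ b by case: a b => [] [].
rewrite /nonorientable; case: existsP => [[s /forallP sP]|no_s] /=.
  rewrite (@potential_self s e chi x) // => [|y|y].
  - have /and3P[_ _] := sP x; rewrite xe eqxx => /flip ->.
    by case: (s x); rewrite addr0.
  - by have /and3P[/flip] := sP y.
  - by have /and3P[_ /flip] := sP y.
pose s y := fconnect nxt x y.
have s_seg y : s (seg y) = ~~ s y by apply: fconnect_seg.
have s_arc y : s (arc y) = ~~ s y by rewrite -s_seg; apply: fconnect_arc.
rewrite (potential_self s_seg s_arc pot xe); case: eqP => // /eqP/flip s_side.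
case: no_s; exists (finfun s); apply/forallP=> y; rewrite !ffunE s_seg s_arc.
rewrite !negb_eqb !addNb !addbb /=; apply/implyP => /eqP.
rewrite -xe => /edge_corners; rewrite !inE => /or4P[] /eqP ->.
- by rewrite s_side; case: (s x).
- by rewrite sideK s_side; case: (s x).
- by rewrite side_segC !s_seg s_side; case: (s x).
by rewrite side_segC -side_segC sideK side_segC !s_seg s_side; case: (s x).
Qed.

(** * Orbit count of a state of the edges *)

Lemma card_kernel n (N : 'M['F_2]_n) :
  #|[set v : 'rV_n | v *m N == 0]| = (2 ^ (n - \rank N))%N.
Proof.
rewrite -mxrank_ker; transitivity #|rowg (kermx N)|; last first.
  by rewrite card_rowg card_Fp.
by apply: eq_card => v; rewrite !inE; apply/eqP/sub_kermxP.
Qed.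

(* The state of an edge is the choice of the involution t on its corners: the
   edge is deleted if t is [seg], kept if t is [side], and kept with a half-twist
   if t is the diagonal [side \o seg]. *)
Section State.
(** [h] enumerates the kept edges. Leaving [h] and [N] abstract serves both the full matrix and its
    principal submatrices. *)
Variables (n : nat) (h : 'I_n -> E) (P : {set E}) (N : 'M['F_2]_n).
Variable t : corner B -> corner B.
Hypothesis h_inj : injective h.
Hypothesis t_out : forall x, edge x \notin codom h -> t x = seg x.
Hypothesis t_in : forall x, edge x \in codom h ->
  t x = if edge x \in P then side (seg x) else side x.
Hypothesis N_entry : forall i j,
  N i j = ((h i != h j) && interlaced B (h i) (h j)
           || (h i == h j) && (h i \in symdiff (nonorientable_loops B) P))%:R.

Lemma edge_state x : edge (t x) = edge x.
Proof.
have [/t_in->|/t_out->] := boolP (edge x \in codom h); last by rewrite edge_seg.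
by case: ifP; rewrite edge_side ?edge_seg.
Qed.

Lemma stateK : involutive t.
Proof.
move=> x; have [xh|xh] := boolP (edge x \in codom h).
  rewrite t_in edge_state // t_in //; case: (_ \in P); last by rewrite sideK.
  by rewrite -side_segC segK sideK.
by rewrite t_out ?edge_state // t_out // segK.
Qed.

Lemma state_seg x : t (seg x) = seg (t x).
Proof.
have [xh|xh] := boolP (edge x \in codom h).
  by rewrite !t_in ?edge_seg //; case: ifP => _; rewrite !side_segC.
by rewrite !t_out ?edge_seg.
Qed.

Lemma state_corners x y : edge x \in codom h -> edge y = edge x ->
  y \in [:: x; t x; seg x; seg (t x)].
Proof.
move=> xh /edge_corners; rewrite t_in //; case: ifP => _; rewrite !side_segC ?segK //.
by rewrite !inE => /or4P[] ->; rewrite ?orbT.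
Qed.

(** The side contributes interlacement or non-orientability; a half-twist crosses one more end,
    which is felt only when [h j = h k]. *)
Lemma potential_state chi j k x : potential (h j) chi -> edge x = h k ->
  chi (t x) = chi x + N j k.
Proof.
move=> pot xk; have [_ chi_seg] := pot.
rewrite t_in xk ?codom_f // side_segC N_entry; have [jk|njk] /= := eqVneq (h j) (h k).
  have chi_side := potential_nonorientable pot (etrans xk (esym jk)).
  have F2_sum (a b : bool) : (a (+) b)%:R = a%:R + b%:R :> 'F_2.
    by case: a b => [] [] //; apply/val_inj.
  have -> : (h j \in symdiff (nonorientable_loops B) P)
            = nonorientable B (h j) (+) (h k \in P).
    by rewrite !inE jk; case: (h k \in P); case: (nonorientable B (h k)).
  rewrite F2_sum; case: (h k \in P); last by rewrite addr0 chi_side.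
  by rewrite chi_seg edge_side xk -jk eqxx chi_side addrA.
rewrite orbF interlaced_sym.
have := potential_interlaced pot xk; rewrite eq_sym njk => /(_ isT) <-.
by case: ifP => _ //; rewrite chi_seg edge_side xk eq_sym (negPf njk) addr0.
Qed.

Lemma state_invariantP (f : corner B -> 'F_2) :
  reflect ((forall x, f (t x) = f x) /\ (forall x, f (arc x) = f x))
          (fun_invariant [:: t; @arc E B] f).
Proof.
rewrite /fun_invariant /= andbT.
by apply: (iffP andP) => -[/'forall_eqP ft /'forall_eqP fa].
Qed.

(** [sol] is a bijection from pairs of a constant and a kernel vector to the invariant functions.
    The vector is read off from the jumps across edge ends, the constant from the value at [x0]. *)
Lemma card_state_invariant (x0 : corner B) :
  #|[set f : {ffun corner B -> 'F_2} | fun_invariant [:: t; @arc E B] f]|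
    = (2 ^ (n - \rank N).+1)%N.
Proof.
have [chi chiP] := fin_all_exists (fun i => potential_exists (h i)).
have [c cP] := fin_all_exists (fun i => edge_surj B (h i)).
pose sol (w : 'F_2 * 'rV['F_2]_n) : {ffun corner B -> 'F_2} :=
  [ffun x => w.1 + \sum_i w.2 0 i * chi i x].
have sol_arc w x : sol w (arc x) = sol w x.
  by rewrite !ffunE; congr (_ + _); apply: eq_bigr => i _; rewrite (chiP i).1.
have sol_seg_out w x : edge x \notin codom h -> sol w (seg x) = sol w x.
  move=> xh; rewrite !ffunE; congr (_ + _); apply: eq_bigr => i _.
  rewrite (chiP i).2; case: eqP => [xi|]; last by rewrite addr0.
  by rewrite xi codom_f in xh.
have sol_seg_in w x k : edge x = h k -> sol w (seg x) = sol w x + w.2 0 k.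
  move=> xk; rewrite !ffunE -addrA; congr (_ + _).
  under eq_bigr => i _ do rewrite (chiP i).2 mulrDr.
  rewrite big_split /=; congr (_ + _); rewrite (bigD1 k) //= xk eqxx mulr1.
  rewrite big1 ?addr0 // => i /negPf nik.
  by rewrite (inj_eq h_inj) eq_sym nik mulr0.
have sol_t w x k : edge x = h k -> sol w (t x) = sol w x + (w.2 *m N) 0 k.
  move=> xk; rewrite !ffunE -addrA; congr (_ + _); rewrite mxE -big_split /=.
  by apply: eq_bigr => i _; rewrite (potential_state (chiP i) xk) mulrDr.
have sol_inj : injective sol.
  move=> [a v] [b w] eq_s; have vw : v = w.
    apply/rowP=> k; have := congr1 (fun f : {ffun _} => f (seg (c k))) eq_s.
    by rewrite !(sol_seg_in _ _ k (cP k)) eq_s => /addrI.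
  have := congr1 (fun f : {ffun _} => f x0) eq_s.
  by rewrite !ffunE vw /= => /addIr ->.
rewrite expnS -card_kernel -[X in (X * _)%N](card_Fp (isT : prime 2)) -cardsT -cardsX.
rewrite -(card_imset _ sol_inj); apply: eq_card => f; rewrite inE.
apply/state_invariantP/imsetP => [[ft fa]|[[a v]]]; last first.
  rewrite !inE /= => /eqP vN ->; split=> // x.
  have [/codomP[k xk]|xh] := boolP (edge x \in codom h).
    by rewrite (sol_t _ _ k xk) /= vN mxE addr0.
  by rewrite t_out // sol_seg_out.
(* The coefficients are the jumps of [f]; invariance under [t] makes the jump the same at both ends
   of an edge. *)
pose v := \row_k (f (seg (c k)) + f (c k)).
have f_seg x k : edge x = h k -> f (seg x) = f x + v 0 k.
  have F2_eq (a b d : 'F_2) : a + b = d -> a = b + d.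
    by move=> <-; rewrite addrC addF2K.
  have ck : edge (c k) \in codom h by rewrite cP codom_f.
  rewrite -(cP k) => /(state_corners ck) xk; apply: F2_eq; rewrite mxE.
  move: xk; rewrite !inE => /or4P[] /eqP ->; rewrite ?segK -?state_seg ?ft //;
    by rewrite addrC.
(* With the jumps removed, what remains is constant on the circle. *)
pose d x := f x - sol (0, v) x.
have d_const x : d x = d x0.
  apply: bouquet_connected => {}x; rewrite /d; last by rewrite fa sol_arc.
  have [/codomP[k xk]|xh] := boolP (edge x \in codom h).
    rewrite (f_seg _ _ xk) (sol_seg_in _ _ _ xk) /= opprD addrACA subrr addr0 //.
  by rewrite -t_out // ft t_out // sol_seg_out.
have f_sol : f = sol (d x0, v).
  apply/ffunP=> x; rewrite -(d_const x) /d !ffunE /= add0r subrK //.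
exists (d x0, v) => //; rewrite !inE /=; apply/eqP/rowP=> k.
(* By [sol_t] the change of [f] along [t] is an entry of [v *m N], so invariance puts [v] in the
   kernel. *)
have := sol_t (d x0, v) _ _ (cP k); rewrite -f_sol ft -{1}[f (c k)]addr0 => /addrI <-.
by rewrite mxE.
Qed.

Lemma norbits_state : (norbits [:: t; @arc E B] + isolated B)%N = (n - \rank N).+1.
Proof.
have norbits0 (s : seq (corner B -> corner B)) : #|corner B| = 0%N -> norbits s = 0%N.
  by move=> B0; apply/eqP; rewrite -leqn0 -B0 /norbits /n_comp_mem max_card.
have v1 : (norbits [:: @seg E B; @arc E B] + isolated B)%N = 1%N := hB.
(* Without corners the bouquet is a bare disc and [n] is 0; otherwise its only vertex carries a
   corner and no disc is isolated. *)
have [B0|] := posnP #|corner B|.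
  rewrite norbits0 // in v1; rewrite norbits0 // v1; congr S.
  have [n0|n_gt0] := posnP n; first by lia.
  by have [x _] := edge_surj B (h (Ordinal n_gt0)); have := card0_eq B0 x.
case/card_gt0P=> x0 _.
have iso0 : isolated B = 0%N.
  suff : (0 < norbits [:: @seg E B; @arc E B])%N by lia.
  apply/card_gt0P; exists (fingraph.root (step [:: @seg E B; @arc E B]) x0).
  rewrite !inE andbT; apply: roots_root.
  by apply/sym_connect_sym/step_sym2; [apply: segK|apply: arcK].
rewrite iso0 addn0; apply: (@expnI 2) => //; rewrite -(card_state_invariant x0).
by rewrite card_invariant //; apply: step_sym2; [apply: stateK|apply: arcK].
Qed.
End State.

(** * Orbit counts as coranks of adjacency matrices *)

Let I := intersection_graph B.
Let S := nonorientable_loops B.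

Lemma norbits_adjmx (P : {set E}) (t : corner B -> corner B) :
  (forall x, t x = if edge x \in P then side (seg x) else side x) ->
  (norbits [:: t; @arc E B] + isolated B)%N
    = (corank (adjmx I (symdiff S P))).+1.
Proof.
move=> tE; apply: (@norbits_state _ enum_val P) => [|x|x _|i j].
- exact: enum_val_inj.
- by rewrite -(enum_rankK (edge x)) codom_f.
- exact: tE.
by rewrite mxE (inj_eq enum_val_inj).
Qed.

Lemma norbits_principal (A P : {set E}) (t : corner B -> corner B) :
  (forall x, t x = if edge x \in A
                   then if edge x \in P then side (seg x) else side x
                   else seg x) ->
  (norbits [:: t; @arc E B] + isolated B)%N
    = (corank (principal (adjmx I (symdiff S P)) A)).+1.
Proof.
move=> tE; apply: (@norbits_state _ (@enum_val _ (mem A)) P) => [|x|x|i j].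
- exact: enum_val_inj.
- rewrite tE; case: ifP => // xA.
  by rewrite -(enum_rankK_in xA xA) codom_f.
- by rewrite tE => /codomP[i ->]; rewrite enum_valP.
by rewrite !mxE !enum_rankK (inj_eq enum_rank_inj) (inj_eq enum_val_inj).
Qed.

(** [seg] and [arc] already connect all corners, so adding [side] does not change the invariant
    functions. *)
Lemma bouquet_ncomponents : ncomponents B = 1%N.
Proof.
rewrite -[RHS]hB /ncomponents /nvertices; congr (_ + _)%N.
apply: norbits_eq => [||f].
- exact: step_sym3 (@sideK _ B) (@segK _ B) (@arcK _ B).
- exact: step_sym2 (@segK _ B) (@arcK _ B).
rewrite /fun_invariant /= !andbT; apply/idP/idP => [/andP[] //|inv].
rewrite inv andbT; apply/'forall_eqP => x.
by case/andP: inv => /'forall_eqP fs /'forall_eqP fa; apply: bouquet_connected.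
Qed.

End Bouquet.

(** * Components and Euler genera of twisted duals *)

(** On each edge, both operations replace [side] and [seg] by two involutions generating the same
    group, so the invariant functions are unchanged. *)
Lemma ncomponents_twisted_dual (E : finType) (G : ribbonGraph E) w (A : {set E}) :
  ncomponents (twisted_dual G w A) = ncomponents G.
Proof.
elim: w => //= l w <-; move: (twisted_dual _ _ _) => {}G.
rewrite /ncomponents; congr (_ + _); last by case: l.
have sym (H : ribbonGraph E) := step_sym3 (@sideK _ H) (@segK _ H) (@arcK _ H).
case: l => /=.
  apply: norbits_eq (sym (partial_dual A G)) (sym G) _ => f.
  rewrite /fun_invariant /= !andbT !andbA; congr (_ && _).
  by apply/andP/andP=> -[/'forall_eqP f1 /'forall_eqP f2];
    split; apply/'forall_eqP => x; move: (f1 x) (f2 x);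
    rewrite /= /dual_side /dual_seg; case: ifP.
apply: norbits_eq (sym (partial_petrial A G)) (sym G) _ => f.
rewrite /fun_invariant /= !andbT !andbA; congr (_ && _).
apply/andP/andP=> -[/'forall_eqP f1 /'forall_eqP f2].
  split; apply/'forall_eqP => x //; move: (f1 (seg x)) (f1 x).
  rewrite /petrie_side edge_seg segK; case: ifP => _ f1x f1y; last exact: f1y.
  by rewrite f1x f2.
split; apply/'forall_eqP => x //=; rewrite /petrie_side.
by case: ifP; rewrite f1 ?f2.
Qed.

Lemma symdiff0 (T : finType) (A : {set T}) : symdiff A set0 = A.
Proof. by rewrite /symdiff setD0 set0D setU0. Qed.

Theorem theorem2p8 (E : finType) (B : ribbonGraph E) (hB : bouquet B)
    (F : {set E}) :
  let I := intersection_graph B in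
  let S := nonorientable_loops B in
  [/\ euler_genus (twisted_dual B [:: tau] F)
        = (\rank (adjmx I (symdiff S F)))%:Z%R,
      euler_genus (twisted_dual B [:: delta] F)
        = ((\rank (principal (adjmx I S) F))%:Z
           + (\rank (principal (adjmx I S) (~: F)))%:Z)%R,
      euler_genus (twisted_dual B [:: delta; tau] F)
        = ((\rank (principal (adjmx I (symdiff S F)) F))%:Z
           + (\rank (principal (adjmx I S) (~: F)))%:Z)%R,
      euler_genus (twisted_dual B [:: tau; delta] F)
        = ((\rank (adjmx I (symdiff S F)))%:Z
           - (corank (principal (adjmx I S) F))%:Z)%R
    & euler_genus (twisted_dual B [:: tau; delta; tau] F)
        = ((\rank (adjmx I S))%:Z
           - (corank (principal (adjmx I (symdiff S F)) F))%:Z)%R].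
Proof.
move=> I S; rewrite /euler_genus /nedges !ncomponents_twisted_dual.
rewrite (bouquet_ncomponents hB).
have full := norbits_adjmx hB; have sub := norbits_principal hB.
rewrite -/I -/S in full sub.
have full0 := full set0; rewrite symdiff0 in full0.
have sub0 A := sub A set0; rewrite symdiff0 in sub0.
pose G w := twisted_dual B w F; rewrite -!/(G _).
pose crkF := corank (principal (adjmx I S) F).
pose crkFc := corank (principal (adjmx I S) (~: F)).
pose crkF_twist := corank (principal (adjmx I (symdiff S F)) F).
(* Each count below is that of a state of [B]: on [F], [delta] exchanges [side] and [seg], and [tau]
   replaces [side] by the diagonal. *)
have v1 : nvertices (G [:: tau]) = 1 := hB.
have f1 : nfaces (G [:: tau]) = (corank (adjmx I (symdiff S F))).+1.
  by apply: (full F (@side E (G [:: tau]))).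
have v2 : nvertices (G [:: delta]) = crkF.+1.
  by apply: (sub0 F (@seg E (G [:: delta]))) => x; rewrite /= /dual_seg inE.
have f2 : nfaces (G [:: delta]) = crkFc.+1.
  apply: (sub0 (~: F) (@side E (G [:: delta]))) => x.
  by rewrite /= /dual_side !inE; case: ifP.
have v3 : nvertices (G [:: delta; tau]) = crkF_twist.+1.
  apply: (sub F F (@seg E (G [:: delta; tau]))) => x.
  rewrite /= /dual_seg /partial_petrial /= /petrie_side.
  by case: (edge x \in F).
have f3 : nfaces (G [:: delta; tau]) = crkFc.+1.
  apply: (sub0 (~: F) (@side E (G [:: delta; tau]))) => x.
  rewrite /= /dual_side /partial_petrial /= /petrie_side !inE.
  by case: (edge x \in F).
have v4 : nvertices (G [:: tau; delta]) = crkF.+1.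
  by apply: (sub0 F (@seg E (G [:: tau; delta]))) => x; rewrite /= /dual_seg inE.
have f4 : nfaces (G [:: tau; delta]) = (corank (adjmx I (symdiff S F))).+1.
  apply: (full F (@side E (G [:: tau; delta]))) => x.
  rewrite /= /petrie_side /partial_dual /= dual_side_segE /dual_side.
  by case: (edge x \in F).
have v5 : nvertices (G [:: tau; delta; tau]) = crkF_twist.+1.
  apply: (sub F F (@seg E (G [:: tau; delta; tau]))) => x.
  rewrite /= /dual_seg /partial_petrial /= /petrie_side.
  by case: (edge x \in F).
(* On [F] the three operations exchange [seg] with the diagonal and restore [side], so the faces are
   those of [B]. *)
have f5 : nfaces (G [:: tau; delta; tau]) = (corank (adjmx I S)).+1.
  apply: (full0 (@side E (G [:: tau; delta; tau]))) => x.
  rewrite inE /= {1}/petrie_side /partial_dual /= dual_side_segE.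
  rewrite /dual_side /partial_petrial /= /petrie_side edge_seg segK.
  by case: (edge x \in F).
rewrite v1 f1 v2 f2 v3 f3 v4 f4 v5 f5 /crkF /crkFc /crkF_twist /corank.
(* The bounds make the truncated subtractions in the coranks exact. *)
have := rank_leq_row (adjmx I (symdiff S F)).
have := rank_leq_row (adjmx I S).
have := rank_leq_row (principal (adjmx I S) F).
have := rank_leq_row (principal (adjmx I S) (~: F)).
have := rank_leq_row (principal (adjmx I (symdiff S F)) F).
by have := cardsC F; split; lia.
Qed.
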